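(* Let $a,b\in\mathbb{C}$ with $b\neq0$, and let $\alpha,\bar\alpha,\beta\in\mathbb{C}$ with $\alpha,\bar\alpha\neq0$. Consider extensions $0\to M_{\bar\alpha,\beta}\to E\to M_{\alpha,\beta}\to0$ of $\mathcal{W}(a,b)$-modules (so $\bar\beta=\beta$), written as $E=\mathbb{C}[\partial]v_{\bar\alpha}\oplus\mathbb{C}[\partial]v_\alpha$ with $L_\lambda v_\alpha=(\partial+\alpha\lambda+\beta)v_\alpha+f(\partial,\lambda)v_{\bar\alpha}$, $W_\lambda v_\alpha=g(\partial,\lambda)v_{\bar\alpha}$. Then in every such extension $g=0$. A nontrivial such extension exists if and only if one of the following holds, and then every nontrivial extension is equivalent to one with $g=0$ and $f(\partial,\lambda)=F(\partial+\beta,\lambda)$ with $F$ as indicated: (i) $\alpha=\bar\alpha$ and $F(\partial,\lambda)=a_0+a_1\lambda$ with $(a_0,a_1)\neq(0,0)$; (ii) $\alpha-\bar\alpha=2$ and $F=c\,\lambda^2(2\partial+\lambda)$, $c\neq0$; (iii) $\alpha-\bar\alpha=3$ and $F=c\,\partial\lambda^2(\partial+\lambda)$, $c\neq0$; (iv) $\alpha-\bar\alpha=4$ and $F=c\,\lambda^2(4\partial^3+6\partial^2\lambda-\partial\lambda^2+\bar\alpha\lambda^3)$, $c\neq0$; (v) $\alpha=1$, $\bar\alpha=-4$ and $F=c(\partial^4\lambda^2-10\partial^2\lambda^4-17\partial\lambda^5-8\lambda^6)$, $c\neq0$; (vi) $\alpha=\frac72\pm\frac{\sqrt{19}}2$,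 $\bar\alpha=-\frac52\pm\frac{\sqrt{19}}2$ (same sign) and $F=c\big(\partial^4\lambda^3-(2\bar\alpha+3)\partial^3\lambda^4-3\bar\alpha\partial^2\lambda^5-(3\bar\alpha+1)\partial\lambda^6-(\bar\alpha+\frac{9}{28})\lambda^7\big)$, $c\neq0$.
   Context: A conformal module over a Lie conformal algebra $\mathcal{R}$ is a $\mathbb{C}[\partial]$-module $V$ with $\mathbb{C}$-linear maps $\mathcal{R}\otimes V\to V[\lambda]$, $a\otimes v\mapsto a_\lambda v$, such that $(\partial a)_\lambda v=-\lambda a_\lambda v$, $a_\lambda(\partial v)=(\partial+\lambda)a_\lambda v$, and $a_\lambda(b_\mu v)-b_\mu(a_\lambda v)=[a_\lambda b]_{\lambda+\mu}v$. The Lie conformal algebra $\mathcal{W}(a,b)$ is the free $\mathbb{C}[\partial]$-module on $L,W$ with $[L_\lambda L]=(\partial+2\lambda)L$, $[L_\lambda W]=(\partial+a\lambda+b)W$, $[W_\lambda W]=0$. For $(a,b)\neq(1,0)$ and $\alpha\neq0$, $M_{\alpha,\beta}=\mathbb{C}[\partial]v$ with $L_\lambda v=(\partial+\alpha\lambda+\beta)v$, $W_\lambda v=0$. Every extension of $M_{\alpha,\beta}$ by $M_{\bar\alpha,\bar\beta}$ can be written in the displayed form with $f,g\in\mathbb{C}[\partial,\lambda]$, where $\mathbb{C}[\partial]v_{\bar\alpha}\cong M_{\bar\alpha,\bar\beta}$ is a submodule. Equivalence of extensions means a module homomorphism between middle terms compatible with the identities on the end terms; trivial means equivalent to the direct sum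 extension. *)

(* Defs.v *)
From HB Require Import structures.
From mathcomp Require Import all_boot all_order all_algebra.
Set Implicit Arguments. Unset Strict Implicit. Unset Printing Implicit Defensive.
Import Order.TTheory GRing.Theory Num.Theory.
Local Open Scope ring_scope.

(* Elements of E = C[d] v_abar (+) C[d] v_al are pairs (p, q) standing for
   p(d) v_abar + q(d) v_al.  Bivariate polynomials f(d, lam) are elements of
   {poly {poly R}}: the OUTER variable is lam, the inner variable is d. *)

Inductive gen := GL | GW.

Definition shiftp (R : fieldType) (l : R) (h : {poly R}) : {poly R} :=
  h \Po ('X + l%:P).
Definition evl (R : fieldType) (l : R) (f : {poly {poly R}}) : {poly R} :=
  f.[l%:P].

Definition eadd (R : fieldType) (v w : {poly R} * {poly R}) :=
  (v.1 + w.1, v.2 + w.2).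
Definition esub (R : fieldType) (v w : {poly R} * {poly R}) :=
  (v.1 - w.1, v.2 - w.2).
Definition escal (R : fieldType) (c : R) (v : {poly R} * {poly R}) :=
  (c *: v.1, c *: v.2).
Definition epmul (R : fieldType) (r : {poly R}) (v : {poly R} * {poly R}) :=
  (r * v.1, r * v.2).
Definition ezero (R : fieldType) : {poly R} * {poly R} := (0, 0).

(* The lambda-action X_lam v (lam specialised to a scalar l) on the extension
   with data f, g:  L_lam v_abar = (d + abar lam + be) v_abar, W_lam v_abar = 0,
   L_lam v_al = (d + al lam + be) v_al + f(d,lam) v_abar,
   W_lam v_al = g(d,lam) v_abar, extended by X_lam (h(d) v) = h(d+lam) X_lam v. *)
Definition act (R : fieldType) (al alb be : R) (f g : {poly {poly R}})
  (X : gen) (l : R) (v : {poly R} * {poly R}) : {poly R} * {poly R} :=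
  match X with
  | GL => (shiftp l v.1 * ('X + (alb * l + be)%:P) + shiftp l v.2 * evl l f,
           shiftp l v.2 * ('X + (al * l + be)%:P))
  | GW => (shiftp l v.2 * evl l g, 0)
  end.

(* Conformal module axiom  X_lam (Y_mu v) - Y_mu (X_lam v) = [X_lam Y]_{lam+mu} v
   for the generators X, Y of W(a,b), with
   [L_lam L]_{lam+mu} = (lam - mu) L_{lam+mu},
   [L_lam W]_{lam+mu} = ((a-1) lam - mu + b) W_{lam+mu},
   [W_lam L]_{lam+mu} = (lam + (1-a) mu - b) W_{lam+mu},
   [W_lam W] = 0. *)
Definition is_ext (R : fieldType) (a b al alb be : R) (f g : {poly {poly R}}) : Prop :=
  forall (l m : R) (v : {poly R} * {poly R}),
  [/\ esub (act al alb be f g GL l (act al alb be f g GL m v))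
           (act al alb be f g GL m (act al alb be f g GL l v))
      = escal (l - m) (act al alb be f g GL (l + m) v),
      esub (act al alb be f g GL l (act al alb be f g GW m v))
           (act al alb be f g GW m (act al alb be f g GL l v))
      = escal ((a - 1) * l - m + b) (act al alb be f g GW (l + m) v),
      esub (act al alb be f g GW l (act al alb be f g GL m v))
           (act al alb be f g GL m (act al alb be f g GW l v))
      = escal (l + (1 - a) * m - b) (act al alb be f g GW (l + m) v)
    & esub (act al alb be f g GW l (act al alb be f g GW m v))
           (act al alb be f g GW m (act al alb be f g GW l v))
      = ezero R].

Definition ext_equiv (R : fieldType) (al alb be : R) (f g f' g' : {poly {poly R}}) : Prop :=
  exists phi : {poly R} * {poly R} -> {poly R} * {poly R},
  [/\ forall v w, phi (eadd v w) = eadd (phi v) (phi w),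
      forall r v, phi (epmul r v) = epmul r (phi v),
      forall p, phi (p, 0) = (p, 0),
      forall v, (phi v).2 = v.2
    & forall X l v, phi (act al alb be f g X l v) = act al alb be f' g' X l (phi v)].

Definition ext_trivial (R : fieldType) (al alb be : R) (f g : {poly {poly R}}) : Prop :=
  ext_equiv al alb be f g 0 0.

Definition subbeta (R : fieldType) (be : R) (F : {poly {poly R}}) : {poly {poly R}} :=
  map_poly (fun p : {poly R} => p \Po ('X + be%:P)) F.

Definition Pd (R : fieldType) : {poly {poly R}} := ('X : {poly R})%:P.
Definition Pl (R : fieldType) : {poly {poly R}} := 'X.
Definition cc (R : fieldType) (c : R) : {poly {poly R}} := c%:P%:P.

Definition cond1 (R : fieldType) (al alb : R) := al = alb.
Definition cond2 (R : fieldType) (al alb : R) := al - alb = 2.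
Definition cond3 (R : fieldType) (al alb : R) := al - alb = 3.
Definition cond4 (R : fieldType) (al alb : R) := al - alb = 4.
Definition cond5 (R : fieldType) (al alb : R) := al = 1 /\ alb = -4.
Definition cond6 (R : fieldType) (al alb : R) :=
  exists s : R, s ^+ 2 = 19 /\ al = 7 / 2 + s / 2 /\ alb = - (5 / 2) + s / 2.

Definition good_pair (R : fieldType) (al alb : R) : Prop :=
  cond1 al alb \/ cond2 al alb \/ cond3 al alb \/ cond4 al alb \/
  cond5 al alb \/ cond6 al alb.

Definition good_F (R : fieldType) (al alb : R) (F : {poly {poly R}}) : Prop :=
  (cond1 al alb /\ exists a0 a1 : R, (a0, a1) != (0, 0) /\
      F = cc a0 + cc a1 * Pl R)
  \/ (cond2 al alb /\ exists c : R, c != 0 /\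
      F = cc c * (Pl R) ^+ 2 * (2 * Pd R + Pl R))
  \/ (cond3 al alb /\ exists c : R, c != 0 /\
      F = cc c * Pd R * (Pl R) ^+ 2 * (Pd R + Pl R))
  \/ (cond4 al alb /\ exists c : R, c != 0 /\
      F = cc c * (Pl R) ^+ 2 * (4 * (Pd R) ^+ 3 + 6 * (Pd R) ^+ 2 * Pl R
                                - Pd R * (Pl R) ^+ 2 + cc alb * (Pl R) ^+ 3))
  \/ (cond5 al alb /\ exists c : R, c != 0 /\
      F = cc c * ((Pd R) ^+ 4 * (Pl R) ^+ 2 - 10 * (Pd R) ^+ 2 * (Pl R) ^+ 4
                  - 17 * Pd R * (Pl R) ^+ 5 - 8 * (Pl R) ^+ 6))
  \/ (cond6 al alb /\ exists c : R, c != 0 /\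
      F = cc c * ((Pd R) ^+ 4 * (Pl R) ^+ 3
                  - cc (2 * alb + 3) * (Pd R) ^+ 3 * (Pl R) ^+ 4
                  - cc (3 * alb) * (Pd R) ^+ 2 * (Pl R) ^+ 5
                  - cc (3 * alb + 1) * Pd R * (Pl R) ^+ 6
                  - cc (alb + 9 / 28) * (Pl R) ^+ 7)).

(* Main.v *)
Require Import Defs.
From HB Require Import structures.
From mathcomp Require Import all_boot all_order all_algebra.
From mathcomp Require Import polyXY ring zify.
Import Order.TTheory GRing.Theory Num.Theory.
Local Open Scope ring_scope.
Set Implicit Arguments.
Unset Strict Implicit.
Unset Printing Implicit Defensive.

(** The relation between L and W at lam = 0 gives b g = 0, hence g = 0. After
    the substitution d -> d + be, the remaining datum f is a 1-cocycle
      (d+l+al m) f(d,l) + (d+alb l) f(d+l,m) - (l <-> m) = (l-m) f(d,l+m)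
    and equivalence of extensions means equality modulo the coboundaries
    (d+alb l) phi(d+l) - (d+al l) phi(d).

    The coefficient of m^1 is an Euler identity: it shows that f is a coboundary
    outside total degree k + 1, where k = al - alb, so only natural k matter.
    In degree k + 1 write f = sum_i c_i d^(k+1-i) l^i. The coefficients of m^0
    and m^1 kill c_0 and c_1 when k > 0, and the coefficients of l^2 m^j
    determine all c_i from c_2 and c_3. Let u be the determinant of (c_2, c_3)
    against the corresponding coefficients of the coboundary of d^k; f is a
    coboundary iff u = 0. For k <= 4 there is no further constraint.
    For k >= 5 the coefficient of l^3 m^4 gives
      (4 alb^2 + 4 (k-1) alb + k^2 - 5 k) u = 0,
    whose first factor has the nonzero root alb = -4 for k = 5 and the roots
    -5/2 +- sqrt(19)/2 for k = 6. For k >= 7 the coefficient of l^3 m^6 yields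
    modulo this relation k (k-1) ... (k-6) u = 0, so u = 0. *)

(** * Polynomial identities tested on values, and the expansion of p(d + l) *)

(** The images of 0, ..., [size p] - 1 would be one more distinct root than the degree of a nonzero
    [p] allows. *)
Lemma poly_eq0_nat (S : idomainType) (p : {poly S}) :
  injective (fun n : nat => n%:R : S) -> (forall n : nat, p.[n%:R] = 0) -> p = 0.
Proof.
move=> injS p0; apply/eqP/negPn/negP => pN0.
have /max_poly_roots := pN0.
move=> /(_ [seq n%:R | n <- iota 0 (size p)]).
rewrite size_map size_iota ltnn (map_inj_uniq injS) iota_uniq.
suff -> : all (root p) [seq n%:R | n <- iota 0 (size p)] by move=> /(_ isT isT).
by apply/allP => _ /mapP[n _ ->]; apply/rootP.
Qed.

(** This is p(d + l), with l as the new outer variable; divided derivatives make the coefficients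
    available over any ring. *)
Definition taylor (S : nzRingType) (p : {poly S}) : {poly {poly S}} :=
  \poly_(j < size p) p^`N(j).

Lemma coef_taylor (S : nzRingType) (p : {poly S}) j : (taylor p)`_j = p^`N(j).
Proof.
rewrite coef_poly; case: ltnP => // le_pj; apply/esym/polyP => i.
by rewrite coef_nderivn coef0 nth_default ?mul0rn // (leq_trans le_pj) ?leq_addr.
Qed.

Lemma horner_taylor (S : comNzRingType) (p : {poly S}) x l :
  (taylor p).[l%:P].[x] = p.[x + l].
Proof.
rewrite (nderiv_taylor p (mulrC x l)) horner_poly horner_sum.
by apply: eq_bigr => i _; rewrite -polyC_exp hornerM hornerC.
Qed.

(** * Cocycles, coboundaries and the coefficients of a coboundary *)

Section Cocycles.
Variable R : numClosedFieldType.
Implicit Types (f g F : {poly {poly R}}) (phi : {poly R}) (al alb be : R).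

Lemma natr_inj : injective (fun n : nat => n%:R : R).
Proof. by move=> m n /eqP; rewrite eqr_nat => /eqP. Qed.

Lemma natr_polyC_inj : injective (fun n : nat => n%:R : {poly R}).
Proof. by move=> m n; rewrite -!polyC_natr => /polyC_inj/natr_inj. Qed.

Lemma natr_polyCC_inj : injective (fun n : nat => n%:R : {poly {poly R}}).
Proof. by move=> m n; rewrite -!(polyC_natr {poly R}) => /polyC_inj/natr_polyC_inj. Qed.

Lemma poly_eqP (p q : {poly R}) : (forall x, p.[x] = q.[x]) -> p = q.
Proof.
move=> pq; apply/subr0_eq/(poly_eq0_nat natr_inj) => n.
by rewrite !hornerE pq subrr.
Qed.

(** Identities in d and lam are proved on values, where [ring] applies, and brought back by
    [ev2_inj]. *)
Definition ev2 f (x l : R) : R := f.[l%:P].[x].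

Lemma ev2_inj f g : (forall x l, ev2 f x l = ev2 g x l) -> f = g.
Proof.
move=> fg; apply/subr0_eq/(poly_eq0_nat natr_polyC_inj) => n; apply: poly_eqP => x.
by rewrite -polyC_natr !hornerE [_.[_].[_]]fg subrr.
Qed.

Lemma ev2D f g x l : ev2 (f + g) x l = ev2 f x l + ev2 g x l.
Proof. by rewrite /ev2 !hornerE. Qed.
Lemma ev2N f x l : ev2 (- f) x l = - ev2 f x l.
Proof. by rewrite /ev2 !hornerE. Qed.
Lemma ev2M f g x l : ev2 (f * g) x l = ev2 f x l * ev2 g x l.
Proof. by rewrite /ev2 !hornerE. Qed.
Lemma ev2X f n x l : ev2 (f ^+ n) x l = ev2 f x l ^+ n.
Proof. by rewrite /ev2 horner_exp horner_exp. Qed.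
Lemma ev2_cc c x l : ev2 (cc c) x l = c.
Proof. by rewrite /ev2 /cc !hornerC. Qed.
Lemma ev2_nat n x l : ev2 n%:R x l = n%:R.
Proof. by rewrite -[RHS](ev2_cc _ x l) /cc !polyC_natr. Qed.
Lemma ev2_Pd x l : ev2 (Pd R) x l = x.
Proof. by rewrite /ev2 /Pd hornerC hornerX. Qed.
Lemma ev2_Pl x l : ev2 (Pl R) x l = l.
Proof. by rewrite /ev2 /Pl hornerX hornerC. Qed.
Lemma ev2_polyC phi x l : ev2 phi%:P x l = phi.[x].
Proof. by rewrite /ev2 hornerC. Qed.
Lemma ev2_taylor phi x l : ev2 (taylor phi) x l = phi.[x + l].
Proof. exact: horner_taylor. Qed.
Definition ev2E := (ev2D, ev2N, ev2M, ev2X, ev2_cc, ev2_nat, ev2_Pd, ev2_Pl,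
  ev2_polyC, ev2_taylor).

Definition cocycle al alb f := forall x l m,
  (x + l + al * m) * ev2 f x l + (x + alb * l) * ev2 f (x + l) m
  - ((x + m + al * l) * ev2 f x m + (x + alb * m) * ev2 f (x + m) l)
  = (l - m) * ev2 f x (l + m).

(** Replacing the generator v_al by v_al + phi(d) v_abar adds this to f. *)
Definition cobound al alb phi : {poly {poly R}} :=
  (Pd R + cc alb * Pl R) * taylor phi - (Pd R + cc al * Pl R) * phi%:P.

Lemma ev2_cobound al alb phi x l : ev2 (cobound al alb phi) x l =
  (x + alb * l) * phi.[x + l] - (x + al * l) * phi.[x].
Proof. by rewrite /cobound !ev2E. Qed.

Lemma cocycle_cobound al alb phi : cocycle al alb (cobound al alb phi).
Proof.
move=> x l m; rewrite !ev2_cobound -(addrA x m l) (addrC m l) !addrA; ring.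
Qed.

Lemma cocycleD al alb f g :
  cocycle al alb f -> cocycle al alb g -> cocycle al alb (f + g).
Proof.
move=> cf cg x l m; rewrite !ev2D [RHS]mulrDr -cf -cg; ring.
Qed.

Lemma cocycleZ al alb c f : cocycle al alb f -> cocycle al alb (cc c * f).
Proof.
move=> cf x l m; rewrite !ev2M !ev2_cc [RHS]mulrCA -cf; ring.
Qed.

Lemma cocycleB al alb f g :
  cocycle al alb f -> cocycle al alb g -> cocycle al alb (f - g).
Proof.
move=> cf cg; have -> : f - g = f + cc (-1) * g by rewrite /cc !polyCN mulN1r.
exact/cocycleD/cocycleZ.
Qed.

Lemma coboundD al alb phi psi :
  cobound al alb (phi + psi) = cobound al alb phi + cobound al alb psi.
Proof. by apply: ev2_inj => x l; rewrite ev2D !ev2_cobound !hornerD; ring. Qed.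
Lemma coboundZ al alb c phi :
  cobound al alb (c *: phi) = cc c * cobound al alb phi.
Proof. by apply: ev2_inj => x l; rewrite ev2M ev2_cc !ev2_cobound !hornerZ; ring. Qed.

Lemma coef_ccM c f i s : (cc c * f)`_i`_s = c * f`_i`_s.
Proof. by rewrite /cc !coefCM. Qed.

Lemma coef_PdM f i s : (Pd R * f)`_i`_s = if s is s'.+1 then f`_i`_s' else 0.
Proof. by rewrite /Pd coefCM coefXM; case: s. Qed.

Lemma coef_PlM f i s : (Pl R * f)`_i`_s = if i is i'.+1 then f`_i'`_s else 0.
Proof. by rewrite /Pl coefXM; case: i => //; rewrite coef0. Qed.

(** The coefficient of d^(n-i) lam^(i+1) in (d + alb lam) (d + lam)^n. *)
Definition weight alb (n i : nat) : R := 'C(n, i.+1)%:R + alb * 'C(n, i)%:R.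

Lemma coef_twist0 alb phi s :
  ((Pd R + cc alb * Pl R) * taylor phi)`_0`_s = if s is s'.+1 then phi`_s' else 0.
Proof.
rewrite mulrDl -mulrA !coefD coef_ccM coef_PdM coef_PlM mulr0 addr0.
by case: s => // s; rewrite coef_taylor coef_nderivn bin0.
Qed.

Lemma coef_twistS alb phi i s :
  ((Pd R + cc alb * Pl R) * taylor phi)`_i.+1`_s =
  weight alb (s + i) i * phi`_(s + i).
Proof.
rewrite /weight mulrDl -mulrA !coefD coef_ccM coef_PdM coef_PlM.
case: s => [|s]; rewrite !coef_taylor !coef_nderivn.
  by rewrite addn0 add0n (@bin_small i i.+1) // binn mulr1n; ring.
rewrite !(addnC s.+1) (addSnnS i) -![phi`_ _ *+ _]mulr_natr; ring.
Qed.

Lemma coef_cobound0 al alb phi s : (cobound al alb phi)`_0`_s = 0.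
Proof.
rewrite /cobound coefB coefB coef_twist0 (mulrDl (Pd R)) -mulrA coefD coefD.
rewrite coef_ccM coef_PdM coef_PlM mulr0 addr0.
by case: s => [|s]; [rewrite subr0 | rewrite coefC subrr].
Qed.

Lemma coef_coboundS al alb phi i s : (cobound al alb phi)`_i.+1`_s =
  weight alb (s + i) i * phi`_(s + i) - (if i == 0 then al * phi`_s else 0).
Proof.
rewrite /cobound coefB coefB coef_twistS (mulrDl (Pd R)) -mulrA coefD coefD.
rewrite coef_ccM coef_PdM coef_PlM.
have -> : phi%:P`_i.+1 = 0 by rewrite coefC.
case: i => [|i]; case: s => [|s]; rewrite ?coef0 ?add0r.
- by rewrite coefC.
- by rewrite coefC.
- by rewrite coefC coef0 mulr0.
by rewrite coefC coef0 mulr0.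
Qed.

Lemma weight0 alb n : weight alb n 0 = n%:R + alb.
Proof. by rewrite /weight bin0 bin1 mulr1. Qed.

Lemma weight_nn alb n : weight alb n n = alb.
Proof. by rewrite /weight binn bin_small // add0r mulr1. Qed.

End Cocycles.

(** * Coefficients of cocycles *)

Section Coefficients.
Variable R : numClosedFieldType.
Implicit Types (f g F : {poly {poly R}}) (phi : {poly R}) (al alb be : R).

(* Trivariate polynomials have outer variable m, middle variable l and inner
   variable d; [twist2 f] is f(d+l,m). *)
Definition twist2 f : {poly {poly {poly R}}} := \poly_(j < size f) taylor f`_j.

Lemma taylor0 : taylor (0 : {poly R}) = 0.
Proof. by apply/polyP => i; rewrite coef_taylor coef0 linear0. Qed.

Lemma coef_twist2 f j : (twist2 f)`_j = taylor f`_j.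
Proof.
by rewrite coef_poly; case: ltnP => // le_fj; rewrite nth_default ?taylor0.
Qed.

Lemma ev3_twist2 f x l m : ev2 (twist2 f).[m%:P%:P] x l = ev2 f (x + l) m.
Proof.
rewrite /twist2 horner_poly /ev2 (horner_coef f) !horner_sum.
apply: eq_bigr => i _; rewrite -!polyC_exp !hornerM !hornerC.
by rewrite horner_taylor.
Qed.

(** The left side of the cocycle identity is this polynomial minus its image under exchanging l and
    m. *)
Definition half al alb f : {poly {poly {poly R}}} :=
  ((Pd R + Pl R) * f)%:P + (cc al * f)%:P * 'X
  + (Pd R + cc alb * Pl R)%:P * twist2 f.

Lemma ev3_half al alb f x l m : ev2 (half al alb f).[m%:P%:P] x l =
  (x + l + al * m) * ev2 f x l + (x + alb * l) * ev2 f (x + l) m.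
Proof.
rewrite /half !hornerD !hornerM !hornerC hornerX !ev2E ev3_twist2 hornerC.
ring.
Qed.

(** Here [taylor] acts on the variable lam of f, so the right side is (l - m) f(d,l+m). Having the
    identity between polynomials allows coefficients to be compared. *)
Lemma cocycle_half al alb f : cocycle al alb f ->
  half al alb f - swapXY (half al alb f) = (Pl R)%:P * taylor f - 'X * taylor f.
Proof.
move=> cf; apply/subr0_eq/(poly_eq0_nat (@natr_polyCC_inj R)) => m.
apply: ev2_inj => x l.
have -> : m%:R = (m%:R : R)%:P%:P :> {poly {poly R}} by rewrite !polyC_natr.
move: (m%:R : R) => {}m.
have := ev3_half al alb f x l m; have := ev3_half al alb f x m l.
move: (half al alb f) => H eml elm.
have et : ev2 (taylor f).[m%:P%:P] x l = ev2 f x (l + m).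
  by rewrite /ev2 horner_taylor polyCD.
have eS : ev2 (swapXY H).[m%:P%:P] x l = ev2 H.[l%:P%:P] x m.
  by rewrite /ev2 horner2_swapXY.
rewrite !(hornerD, hornerN, hornerM) hornerC hornerX !(ev2D, ev2N, ev2M) eS elm eml.
rewrite et cf ev2_Pl (ev2_cc m) /ev2 horner0 horner0; ring.
Qed.

Lemma coef_half al alb f j i s : (half al alb f)`_j`_i`_s =
  (if j == 0 then ((Pd R + Pl R) * f)`_i`_s else 0)
  + (if j == 1 then al * f`_i`_s else 0)
  + ((Pd R + cc alb * Pl R) * taylor f`_j)`_i`_s.
Proof.
rewrite /half !coefD coefC coefMX coefC coefCM coef_twist2.
congr (_ + _ + _); first by case: eqP => //; rewrite !coef0.
case: j => [|[|j]] /=; rewrite ?coef0 //.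
by rewrite coef_ccM.
Qed.

Lemma coef_cocycle al alb f j i s : cocycle al alb f ->
  (half al alb f)`_j`_i`_s - (half al alb f)`_i`_j`_s =
  (if i is i'.+1 then f`_(j + i')`_s * 'C(j + i', j)%:R else 0)
  - (if j is j'.+1 then f`_(j' + i)`_s * 'C(j' + i, j')%:R else 0).
Proof.
move=> /cocycle_half; move: (half al alb f) => H.
move=> /(congr1 (fun p : {poly {poly {poly R}}} => p`_j`_i`_s)).
rewrite !(coefD, coefN) coef_swapXY coefCM coef_PlM coefXM => ->.
congr (_ - _).
  by case: i => // i; rewrite coef_taylor coef_nderivn coefMn mulr_natr.
case: j => [|j] /=; first by rewrite !coef0.
by rewrite coef_taylor coef_nderivn coefMn mulr_natr.
Qed.

(** Coefficient of m^0 l^(s+2) d^0; the two terms in lam^(s+1) d^0 cancel. *)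
Lemma cocycle_coef0S al alb f s : cocycle al alb f -> alb * f`_0`_s.+1 = 0.
Proof.
move=> /(coef_cocycle 0 s.+2 0).
rewrite !coef_half /= coef_twistS coef_twist0 (mulrDl (Pd R)) !coefD coef_PdM coef_PlM.
rewrite !add0n weight_nn bin0 => h.
apply: (etrans _ (etrans (congr1 (fun z => z - f`_s.+1`_0) h) _)); ring.
Qed.

Lemma cocycle_coef00 al alb f : cocycle al alb f -> (alb - al) * f`_0`_0 = 0.
Proof.
move=> /(coef_cocycle 0 1 0).
rewrite !coef_half /= coef_twistS coef_twist0 (mulrDl (Pd R)) !coefD coef_PdM coef_PlM.
rewrite !add0n weight_nn bin0 => h.
apply: (etrans _ (etrans (congr1 (fun z => z - f`_0`_0) h) _)); ring.
Qed.

(** Coefficient of m l^(i+2) d^s. Outside total degree al - alb + 1 it recovers the coefficients of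
    lam^2 and higher from that of lam. *)
Lemma cocycle_coef1 al alb f i s : cocycle al alb f ->
  (al - alb - (s + i.+1)%:R) * f`_i.+2`_s
  + weight alb (s + i.+1) i.+1 * f`_1`_(s + i.+1) = 0.
Proof.
move=> /(coef_cocycle 1 i.+2 s).
rewrite !coef_half /= !coef_twistS weight0 addn0 add1n bin1 add0n bin0 => h.
apply: (etrans _ (etrans (congr1 (fun z => z - i.+1%:R * f`_i.+2`_s) h) _)); rewrite ?natrD; ring.
Qed.

(** Coefficient of m^(j+2) l^(i+2) d^s. The untwisted terms of [half] have degree at most 1 in l or
    in m, so [al] disappears. *)
Lemma cocycle_coefSS al alb f i j s : cocycle al alb f ->
  weight alb (s + i.+1) i.+1 * f`_j.+2`_(s + i.+1)
  - weight alb (s + j.+1) j.+1 * f`_i.+2`_(s + j.+1)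
  = ('C(j + i.+3, j.+2)%:R - 'C(j + i.+3, j.+1)%:R) * f`_(j + i.+3)`_s.
Proof.
move=> /(coef_cocycle j.+2 i.+2 s).
rewrite !coef_half /= !coef_twistS !add0r => ->.
rewrite -!addSnnS; ring.
Qed.

End Coefficients.

(** * Homogeneous cocycles *)

Section Homogeneous.
Variable R : numClosedFieldType.
Implicit Types (f g F : {poly {poly R}}) (phi : {poly R}) (al alb be : R).

(** Unfolds binomials into polynomials in n, on which [field] can work. *)
Lemma binSr (n i : nat) :
  'C(n, i.+1)%:R = (n%:R - i%:R) / i.+1%:R * 'C(n, i)%:R :> R.
Proof.
have iN0 : i.+1%:R != 0 :> R by rewrite pnatr_eq0.
apply: (mulfI iN0); rewrite -natrM mul_bin_left natrM mulrA [_ * (_ / _)]mulrC mulfVK //.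
case: (leqP i n) => [le_in|lt_ni]; first by rewrite natrB.
by rewrite bin_small // !mulr0.
Qed.

Lemma cocycle_reduce al alb f : cocycle al alb f -> alb != 0 ->
  exists phi, [/\ cocycle al alb (f - cobound al alb phi),
    forall s, (f - cobound al alb phi)`_0`_s.+1 = 0,
    (al - alb) * (f - cobound al alb phi)`_0`_0 = 0 &
    forall i s, (s + i)%:R != al - alb -> (f - cobound al alb phi)`_i.+1`_s = 0].
Proof.
move=> cf alb0.
(* The coboundary of d^s has lam d^s coefficient s - (al - alb); dividing by it removes the
   lam-linear part of f wherever this is nonzero. *)
pose phi := \poly_(s < size f`_1)
  (if s%:R == al - alb then 0 else f`_1`_s / (s%:R - (al - alb))).
have phiE s : s%:R != al - alb -> phi`_s = f`_1`_s / (s%:R - (al - alb)).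
  move=> /negbTE sN; rewrite coef_poly sN; case: ltnP => // le_s.
  by rewrite nth_default // mul0r.
have cf' : cocycle al alb (f - cobound al alb phi).
  exact/cocycleB/cocycle_cobound.
exists phi; split => //.
- move=> s; have /eqP := cocycle_coef0S s cf'; rewrite mulf_eq0 (negbTE alb0).
  by move/eqP.
- by have /eqP := cocycle_coef00 cf'; rewrite -(opprB al alb) mulNr oppr_eq0 => /eqP.
move=> i s sN; rewrite coefB coefB coef_coboundS phiE //.
have dN : (s + i)%:R - (al - alb) != 0 by rewrite subr_eq0.
case: i => [|i] in sN dN *; rewrite /=.
  rewrite addn0 in sN dN *; rewrite weight0 phiE //; field.
  exact: dN.
have := cocycle_coef1 i s cf.
move=> /eqP; rewrite addr_eq0 => /eqP h.
rewrite subr0 mulrA -[_ * f`_1`_ _]opprK -h; field.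
  by move: dN; rewrite natrD -natr1 [i%:R + 1]addrC.
Qed.

(** The relation of l^2 m^(i-1) carries the coefficient of lam^i with factor C(i,1) - C(i,2) = i (3
    - i) / 2. It vanishes at i = 3, so the recursion starts only at i = 4. *)
Lemma cocycle_rigid al alb f : cocycle al alb f ->
  (forall i s, (i < 4)%N -> f`_i`_s = 0) -> f = 0.
Proof.
move=> cf f0; suff fi i s : f`_i`_s = 0.
  by apply/polyP => i; apply/polyP => s; rewrite fi !coef0.
elim/ltn_ind: i s => i IH s; case: (ltnP i 4) => [/f0 //|].
case: i IH => [|[|[|[|n]]]] // IH _.
have := cocycle_coefSS 0 n.+1 s cf; rewrite (IH n.+3) // (IH 2%N) // !mulr0 subrr.
rewrite addSn addn3 => /esym/eqP; rewrite mulf_eq0 => /orP[|/eqP //].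
rewrite subr_eq0 eqr_nat -bin_sub // -[X in _ == X]bin_sub; last by lia.
rewrite !subSS !subSnn bin1 subSn // subSnn => /eqP; rewrite 2!binS !bin1; lia.
Qed.

(** Divisibility by lam^2 is included: for al - alb = k it holds for the coboundary of d^k, and for
    reduced cocycles when k > 0. *)
Definition is_homog (k : nat) f :=
  forall i s, (i + s != k.+1)%N || (i < 2)%N -> f`_i`_s = 0.

Lemma is_homogD k f g : is_homog k f -> is_homog k g -> is_homog k (f + g).
Proof. by move=> hf hg i s h; rewrite coefD coefD hf // hg // addr0. Qed.

Lemma is_homogB k f g : is_homog k f -> is_homog k g -> is_homog k (f - g).
Proof. by move=> hf hg i s h; rewrite coefB coefB hf // hg // subr0. Qed.

Lemma is_homogZ k c f : is_homog k f -> is_homog k (cc c * f).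
Proof. by move=> hf i s h; rewrite coef_ccM hf // mulr0. Qed.

Lemma is_homog_coboundXn k al alb : al - alb = k%:R ->
  is_homog k (cobound al alb 'X^k).
Proof.
move=> alk [|i] s; first by rewrite coef_cobound0.
rewrite coef_coboundS !coefXn addSn eqSS addnC.
case: i => [|i] /=; rewrite ?addn0.
  move=> _; rewrite weight0; case: eqP => [->|]; last by rewrite !mulr0 subr0.
  by rewrite -alk; ring.
by rewrite orbF => /negbTE->; rewrite mulr0 subr0.
Qed.

Lemma homogeneous_rigid k al alb f : cocycle al alb f -> is_homog k f ->
  f`_2`_(k - 1) = 0 -> f`_3`_(k - 2) = 0 -> f = 0.
Proof.
move=> cf hf f2 f3; apply: (cocycle_rigid cf) => i s lti.
case: (boolP ((i + s != k.+1)%N || (i < 2)%N)) => [/hf //|].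
rewrite negb_or negbK -leqNgt => /andP[/eqP is_k i2].
have [i_eq|i_eq] : i = 2%N \/ i = 3%N by lia.
  by rewrite i_eq (_ : s = (k - 1)%N) //; lia.
by rewrite i_eq (_ : s = (k - 2)%N) //; lia.
Qed.

Lemma homogeneous_match k al alb f F t : al - alb = k%:R -> (0 < k)%N ->
  cocycle al alb f -> is_homog k f -> cocycle al alb F -> is_homog k F ->
  f`_2`_(k - 1) = F`_2`_(k - 1) + t * weight alb k 1 ->
  f`_3`_(k - 2) = F`_3`_(k - 2) + t * weight alb k 2 ->
  f = F + cobound al alb (t *: 'X^k).
Proof.
move=> alk k0 cf hf cF hF f2 f3; apply/subr0_eq; rewrite coboundZ.
have hc : is_homog k (cc t * cobound al alb 'X^k) by apply/is_homogZ/is_homog_coboundXn.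
apply: (@homogeneous_rigid k al alb).
- apply/cocycleB/cocycleD/cocycleZ/cocycle_cobound => //.
- by apply/is_homogB/is_homogD.
- rewrite 2!coefB 2!coefD coef_ccM coef_coboundS f2 subnK // coefXn eqxx /=; ring.
rewrite 2!coefB 2!coefD f3.
case: k k0 {f2 f3 hc cF cf hf hF} alk => [|[|k]] // _ alk.
  (* For k = 1 the truncated index k - 2 is 0, and the lam^3 coefficient of the coboundary is 0 as
     well. *)
  have -> : weight alb 1 2 = 0 by rewrite /weight !bin_small // mulr0 addr0.
  rewrite coef_ccM coef_coboundS coefXn /=; ring.
rewrite coef_ccM coef_coboundS subnK // coefXn eqxx /=; ring.
Qed.

(** Lists shorter than k + 2 are padded with zeros, as happens for k = 3 in the classification. *)
Definition homog (k : nat) (a : seq R) : {poly {poly R}} :=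
  \poly_(i < k.+2) (a`_i *: 'X^(k.+1 - i)).

Lemma coef_homog k a i s :
  (homog k a)`_i`_s = if (i + s == k.+1)%N then a`_i else 0.
Proof.
rewrite coef_poly; case: ltnP => [le_ik|lt_ki].
  rewrite coefZ coefXn -(eqn_add2l i) subnKC //.
  by case: eqP; rewrite ?mulr1 ?mulr0.
by rewrite coef0 gtn_eqF // ltn_addr.
Qed.

Lemma ev2_homog k a x l :
  ev2 (homog k a) x l = \sum_(i < k.+2) a`_i * x ^+ (k.+1 - i) * l ^+ i.
Proof.
rewrite /ev2 horner_poly horner_sum; apply: eq_bigr => i _.
by rewrite -polyC_exp hornerM hornerC hornerZ hornerXn.
Qed.

Lemma is_homog_homog k a : a`_0 = 0 -> a`_1 = 0 -> is_homog k (homog k a).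
Proof.
move=> a0 a1 i s; rewrite coef_homog; case: eqP => //= _.
by case: i => [|[|i]].
Qed.

(* The determinant condition says that [homog k a] and the coboundary of [d^k]
   are independent already in their coefficients of lam^2 and lam^3. *)
Lemma homogeneous_decompose k al alb a f : al - alb = k%:R -> (1 < k)%N ->
  a`_0 = 0 -> a`_1 = 0 -> cocycle al alb (homog k a) ->
  a`_2 * weight alb k 2 - a`_3 * weight alb k 1 != 0 ->
  cocycle al alb f -> is_homog k f ->
  exists c t, f = cc c * homog k a + cobound al alb (t *: 'X^k).
Proof.
move=> alk k1 a0 a1 ca dN cf hf.
have e2 : (2 + (k - 1) = k.+1)%N by lia.
have e3 : (3 + (k - 2) = k.+1)%N by lia.
set d := _ - _ in dN; set c2 := f`_2`_(k - 1); set c3 := f`_3`_(k - 2).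
(* Cramer's rule for the coefficients of lam^2 and lam^3, with determinant [d]. *)
exists ((c2 * weight alb k 2 - c3 * weight alb k 1) / d).
exists ((a`_2 * c3 - a`_3 * c2) / d).
apply: (homogeneous_match alk) => //; first exact: ltnW.
- exact: cocycleZ.
- exact/is_homogZ/is_homog_homog.
- rewrite coef_ccM coef_homog e2 eqxx -/c2 /d; field.
  exact: dN.
- rewrite coef_ccM coef_homog e3 eqxx -/c3 /d; field.
  exact: dN.
Qed.

(** Only the d^k term of [phi] reaches the two coefficients compared, so for a coboundary the
    determinant is 0. *)
Lemma homog_nontrivial k al alb a phi : al - alb = k%:R -> (1 < k)%N ->
  a`_2 * weight alb k 2 - a`_3 * weight alb k 1 != 0 ->
  homog k a <> cobound al alb phi.
Proof.
move=> alk k1 dN e; case/negP: dN; apply/eqP.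
have e2 : (2 + (k - 1) = k.+1)%N by lia.
have e3 : (3 + (k - 2) = k.+1)%N by lia.
have := congr1 (fun f : {poly {poly R}} => f`_2`_(k - 1)) e.
have := congr1 (fun f : {poly {poly R}} => f`_3`_(k - 2)) e.
rewrite !coef_homog !coef_coboundS /= !subnK ?(ltnW k1) //.
rewrite e2 e3 !eqxx => -> ->; ring.
Qed.

(** The coboundary of d^k is thus nonzero at lam^2 or lam^3, which is what lets a vanishing
    determinant force proportionality. The hypothesis gives alb = -(k-1)/2, and then the second
    weight is -k(k-1)(k+1)/12. *)
Lemma weight_indep alb k : (1 < k)%N -> weight alb k 1 = 0 -> weight alb k 2 != 0.
Proof.
move=> k1; rewrite /weight !binSr bin0 => w1.
have kN0 : k%:R != 0 :> R by rewrite pnatr_eq0; lia.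
have albE : alb = - (k%:R - 1) / 2.
  apply: (mulfI kN0); apply/subr0_eq; rewrite -[RHS]w1; by field.
rewrite albE.
rewrite (_ : _ + _ = - (k%:R * (k%:R - 1) * (k%:R + 1) / 12)); last by field.
have k1' : k%:R - 1 != 0 :> R by rewrite subr_eq0 pnatr_eq1; lia.
have k2 : k%:R + 1 != 0 :> R by rewrite natr1 pnatr_eq0.
have n12 : 12 != 0 :> R by rewrite pnatr_eq0.
by rewrite oppr_eq0 !mulf_eq0 invr_eq0 !negb_or kN0 k1' k2 n12.
Qed.

Lemma homogeneous_trivial k al alb f : al - alb = k%:R -> (1 < k)%N ->
  cocycle al alb f -> is_homog k f ->
  f`_2`_(k - 1) * weight alb k 2 - f`_3`_(k - 2) * weight alb k 1 = 0 ->
  exists t, f = cobound al alb (t *: 'X^k).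
Proof.
move=> alk k1 cf hf u0.
have c0 : cocycle al alb 0 by move=> x l m; rewrite /ev2 !horner0; ring.
have h0 : is_homog k (0 : {poly {poly R}}) by move=> i s _; rewrite !coef0.
have [w1|w1] := eqVneq (weight alb k 1) 0.
  have w2 := weight_indep k1 w1.
  exists (f`_3`_(k - 2) / weight alb k 2); rewrite -[RHS]add0r.
  apply: (homogeneous_match alk) => //; first exact: ltnW.
    move: u0; rewrite w1 !mulr0 subr0 !coef0 addr0 => /eqP.
    by rewrite mulf_eq0 (negbTE w2) orbF => /eqP.
  by rewrite !coef0 add0r mulfVK.
exists (f`_2`_(k - 1) / weight alb k 1); rewrite -[RHS]add0r.
apply: (homogeneous_match alk) => //; first exact: ltnW.
  by rewrite !coef0 add0r mulfVK.
rewrite !coef0 add0r mulrAC; apply: (mulIf w1).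
by rewrite mulfVK //; apply/esym/subr0_eq.
Qed.

End Homogeneous.

(** * Obstructions in degrees 5 and 7 *)

Section Obstruction.
Variable R : numClosedFieldType.
Implicit Types (f g F : {poly {poly R}}) (phi : {poly R}) (al alb be : R).

(** The binomial coefficient as a polynomial in x: the obstructions become polynomial identities in
    an indeterminate K. *)
Fixpoint binr (x : R) (i : nat) : R :=
  if i is i'.+1 then (x - i'%:R) / i'.+1%:R * binr x i' else 1.

Definition weightr (A x : R) (i : nat) : R := binr x i.+1 + A * binr x i.

Lemma weightE alb n i : weight alb n i = weightr alb n%:R i.
Proof.
have binE j : 'C(n, j)%:R = binr n%:R j.
  by elim: j => [|j IH]; rewrite ?bin0 //= binSr IH.
by rewrite /weight /weightr !binE.
Qed.

Definition quadric (A K : R) : R := 4 * A ^+ 2 + 4 * (K - 1) * A + K ^+ 2 - 5 * K.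

(** The first three hypotheses, from l^2 m^3, l^2 m^4 and l^2 m^5, express c4, c5, c6 through c2,
    c3. The last, from l^3 m^4, computes c6 a second time, and the two values must agree. *)
Lemma obstruction5_alg (A K c2 c3 c4 c5 c6 : R) :
  weightr A (K - 2) 1 * c3 - weightr A (K - 1) 2 * c2 = - 2 * c4 ->
  weightr A (K - 3) 1 * c4 - weightr A (K - 1) 3 * c2 = - 5 * c5 ->
  weightr A (K - 4) 1 * c5 - weightr A (K - 1) 4 * c2 = - 9 * c6 ->
  weightr A (K - 3) 2 * c4 - weightr A (K - 2) 3 * c3 = - 5 * c6 ->
  (K - 2) * (K - 3) * (K - 4) *
    (quadric A K * (c2 * weightr A K 2 - c3 * weightr A K 1)) = 0.
Proof.
move=> e4 e5 e6 e34.
have c4E : c4 = (weightr A (K - 2) 1 * c3 - weightr A (K - 1) 2 * c2) / (- 2).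
  by rewrite e4; field.
have c5E : c5 = (weightr A (K - 3) 1 * c4 - weightr A (K - 1) 3 * c2) / (- 5).
  by rewrite e5; field.
have c6E : c6 = (weightr A (K - 4) 1 * c5 - weightr A (K - 1) 4 * c2) / (- 9).
  by rewrite e6; field.
have /eqP := e34; rewrite -subr_eq0 => /eqP z; clear e4 e5 e6 e34.
(* After elimination the left side is 72 K times the defect of the l^3 m^4 relation. *)
rewrite -[RHS](mulr0 (72 * K)) -{}z c6E c5E c4E /weightr /quadric /=.
by field.
Qed.

(** Same elimination up to c8, which is computed both from l^2 m^7 and from l^3 m^6. *)
Lemma obstruction7_alg (A K c2 c3 c4 c5 c6 c7 c8 : R) :
  weightr A (K - 2) 1 * c3 - weightr A (K - 1) 2 * c2 = - 2 * c4 ->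
  weightr A (K - 3) 1 * c4 - weightr A (K - 1) 3 * c2 = - 5 * c5 ->
  weightr A (K - 4) 1 * c5 - weightr A (K - 1) 4 * c2 = - 9 * c6 ->
  weightr A (K - 5) 1 * c6 - weightr A (K - 1) 5 * c2 = - 14 * c7 ->
  weightr A (K - 6) 1 * c7 - weightr A (K - 1) 6 * c2 = - 20 * c8 ->
  weightr A (K - 5) 2 * c6 - weightr A (K - 2) 5 * c3 = - 28 * c8 ->
  quadric A K * (c2 * weightr A K 2 - c3 * weightr A K 1) = 0 ->
  K * (K - 1) * (K - 2) * (K - 3) * (K - 4) * (K - 5) * (K - 6) *
    (c2 * weightr A K 2 - c3 * weightr A K 1) = 0.
Proof.
move=> e4 e5 e6 e7 e8 e36 z5.
have c4E : c4 = (weightr A (K - 2) 1 * c3 - weightr A (K - 1) 2 * c2) / (- 2).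
  by rewrite e4; field.
have c5E : c5 = (weightr A (K - 3) 1 * c4 - weightr A (K - 1) 3 * c2) / (- 5).
  by rewrite e5; field.
have c6E : c6 = (weightr A (K - 4) 1 * c5 - weightr A (K - 1) 4 * c2) / (- 9).
  by rewrite e6; field.
have c7E : c7 = (weightr A (K - 5) 1 * c6 - weightr A (K - 1) 5 * c2) / (- 14).
  by rewrite e7; field.
have c8E : c8 = (weightr A (K - 6) 1 * c7 - weightr A (K - 1) 6 * c2) / (- 20).
  by rewrite e8; field.
have /eqP := e36; rewrite -subr_eq0 => /eqP z; clear e4 e5 e6 e7 e8 e36.
(* [Q] is the quotient of the l^3 m^6 obstruction by the quadric; the remainder
   is - K (K - 1) / 28800. *)
pose Q := (12 * A ^+ 2 + (12 * K - 72) * A + 3 * K ^+ 2 - 37 * K + 121) / (144 * 100 * 6).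
transitivity (144 * 100 * 2 * ((K - 2) * (K - 3) * (K - 4) * (K - 5) * (K - 6) * Q *
   (quadric A K * (c2 * weightr A K 2 - c3 * weightr A K 1)) - K / 2 *
   (weightr A (K - 5) 2 * c6 - weightr A (K - 2) 5 * c3 - - 28 * c8))).
  rewrite c8E c7E c6E c5E c4E /Q /weightr /quadric /=; clear.
  by field.
by rewrite z5 z !mulr0 subrr mulr0.
Qed.

End Obstruction.

(** * Classification of cocycles *)

Section Classification.
Variable R : numClosedFieldType.
Implicit Types (f g F : {poly {poly R}}) (phi : {poly R}) (al alb be : R).

(** [cocycle_coefSS] in total degree n + 1, with weights polynomial in n. Indices enter through
    equations so that truncated subtractions are settled at each use. *)
Lemma cocycle_relr al alb f i j s n p q (d : R) : cocycle al alb f ->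
  n = (i + j + 2 + s)%N -> p = (s + i.+1)%N -> q = (s + j.+1)%N ->
  'C(j + i.+3, j.+2)%:R - 'C(j + i.+3, j.+1)%:R = d ->
  weightr alb (n%:R - j.+1%:R) i.+1 * f`_j.+2`_p
  - weightr alb (n%:R - i.+1%:R) j.+1 * f`_i.+2`_q
  = d * f`_(j + i.+3)`_s.
Proof.
move=> cf -> -> -> <-; rewrite -(cocycle_coefSS i j s cf) !weightE.
by congr (weightr _ _ _ * _ - weightr _ _ _ * _); rewrite !natrD -!natr1; ring.
Qed.

Lemma obstruction5 al alb f k : (4 < k)%N -> cocycle al alb f ->
  quadric alb k%:R *
    (f`_2`_(k - 1) * weight alb k 2 - f`_3`_(k - 2) * weight alb k 1) = 0.
Proof.
move=> k4 cf; rewrite !weightE.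
have kN j : (j < 5)%N -> k%:R - j%:R != 0 :> R.
  by move=> ltj; rewrite subr_eq0 eqr_nat; lia.
have knz : (k%:R - 2) * (k%:R - 3) * (k%:R - 4) != 0 :> R.
  by rewrite !mulf_neq0 ?kN.
apply: (mulfI knz); rewrite mulr0.
apply: (@obstruction5_alg R alb k%:R _ _ f`_4`_(k - 3) f`_5`_(k - 4) f`_6`_(k - 5)).
- by apply: (@cocycle_relr al alb f 0 1 (k - 3) k) => //;
    [lia|lia|lia|rewrite !binSr !bin0; field].
- by apply: (@cocycle_relr al alb f 0 2 (k - 4) k) => //;
    [lia|lia|lia|rewrite !binSr !bin0; field].
- by apply: (@cocycle_relr al alb f 0 3 (k - 5) k) => //;
    [lia|lia|lia|rewrite !binSr !bin0; field].
- by apply: (@cocycle_relr al alb f 1 2 (k - 5) k) => //;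
    [lia|lia|lia|rewrite !binSr !bin0; field].
Qed.

(** The relations reach down to d^(k-7), so they require k >= 7; in that range k (k-1) ... (k-6) is
    nonzero and cancels. *)
Lemma obstruction7 al alb f k : (6 < k)%N -> cocycle al alb f ->
  f`_2`_(k - 1) * weight alb k 2 - f`_3`_(k - 2) * weight alb k 1 = 0.
Proof.
move=> k6 cf; have := obstruction5 (ltnW (ltnW k6)) cf; rewrite !weightE => z5.
have kN j : (j < 7)%N -> k%:R - j%:R != 0 :> R.
  by move=> ltj; rewrite subr_eq0 eqr_nat; lia.
have kN0 : k%:R != 0 :> R by rewrite pnatr_eq0; lia.
have knz : k%:R * (k%:R - 1) * (k%:R - 2) * (k%:R - 3) * (k%:R - 4) * (k%:R - 5)
    * (k%:R - 6) != 0 :> R.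
  by rewrite !mulf_neq0 ?kN0 ?kN ?(kN 1).
apply: (mulfI knz); rewrite mulr0.
apply: (@obstruction7_alg R alb k%:R _ _ f`_4`_(k - 3) f`_5`_(k - 4) f`_6`_(k - 5)
  f`_7`_(k - 6) f`_8`_(k - 7)) => //.
- by apply: (@cocycle_relr al alb f 0 1 (k - 3) k) => //;
    [lia|lia|lia|rewrite !binSr !bin0; field].
- by apply: (@cocycle_relr al alb f 0 2 (k - 4) k) => //;
    [lia|lia|lia|rewrite !binSr !bin0; field].
- by apply: (@cocycle_relr al alb f 0 3 (k - 5) k) => //;
    [lia|lia|lia|rewrite !binSr !bin0; field].
- by apply: (@cocycle_relr al alb f 0 4 (k - 6) k) => //;
    [lia|lia|lia|rewrite !binSr !bin0; field].
- by apply: (@cocycle_relr al alb f 0 5 (k - 7) k) => //;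
    [lia|lia|lia|rewrite !binSr !bin0; field].
- by apply: (@cocycle_relr al alb f 1 4 (k - 7) k) => //;
    [lia|lia|lia|rewrite !binSr !bin0; field].
Qed.

(* The entry of index i is the coefficient of d^(k+1-i) lam^i. *)
Definition class_coefs (k : nat) (alb : R) : seq R :=
  match k with
  | 2 => [:: 0; 0; 2; 1]
  | 3 => [:: 0; 0; 1; 1]
  | 4 => [:: 0; 0; 4; 6; -1; alb]
  | 5 => [:: 0; 0; 1; 0; -10; -17; -8]
  | 6 => [:: 0; 0; 0; 1; - (2 * alb + 3); - (3 * alb); - (3 * alb + 1);
             - (alb + 9 / 28)]
  | _ => [::]
  end.

(** For k = 5, 6 these are the zeros of [quadric], without alb = 0 for k = 5. For k = 1 every
    homogeneous cocycle is a coboundary, and k = 0 is treated apart. *)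
Definition class_exists (k : nat) (alb : R) : Prop :=
  match k with
  | 2 | 3 | 4 => True
  | 5 => alb = -4
  | 6 => 2 * alb ^+ 2 + 10 * alb + 3 = 0
  | _ => False
  end.

Lemma cocycle_class k al alb : class_exists k alb -> al - alb = k%:R ->
  cocycle al alb (homog k (class_coefs k alb)).
Proof.
move=> sk /eqP; rewrite subr_eq => /eqP->; case: k sk => [|[|[|[|[|[|[|]]]]]]] //= sk x l m.
- by rewrite !ev2_homog !big_ord_recr !big_ord0 /= ; ring.
- by rewrite !ev2_homog !big_ord_recr !big_ord0 /= ; ring.
- by rewrite !ev2_homog !big_ord_recr !big_ord0 /= ; ring.
- by rewrite !ev2_homog !big_ord_recr !big_ord0 /= sk; ring.
(* The defect is a multiple of the quadratic relation; [F1] is the part of the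
   cochain linear in [alb]. *)
pose F1 y n : R := - 2 * y ^+ 3 * n ^+ 4 - 3 * y ^+ 2 * n ^+ 5 - 3 * y * n ^+ 6 - n ^+ 7.
apply/subr0_eq; transitivity
  ((m * F1 x l + l * F1 (x + l) m - l * F1 x m - m * F1 (x + m) l) / 2
   * (2 * alb ^+ 2 + 10 * alb + 3)); last by rewrite sk mulr0.
by rewrite /F1 !ev2_homog !big_ord_recr !big_ord0 /=; field.
Qed.

Lemma class_det k alb : class_exists k alb ->
  (class_coefs k alb)`_2 * weight alb k 2 - (class_coefs k alb)`_3 * weight alb k 1 != 0.
Proof.
case: k => [|[|[|[|[|[|[|]]]]]]] //= sk; rewrite !weightE /weightr /=.
- by rewrite (_ : _ - _ = - 1%:R) ?oppr_eq0 ?pnatr_eq0 //; field.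
- by rewrite (_ : _ - _ = - 2%:R) ?oppr_eq0 ?pnatr_eq0 //; field.
- by rewrite (_ : _ - _ = - 20%:R) ?oppr_eq0 ?pnatr_eq0 //; field.
- by rewrite sk (_ : _ - _ = - 30%:R) ?oppr_eq0 ?pnatr_eq0 //; field.
rewrite (_ : _ - _ = - 3 * (2 * alb + 5)); last by field.
(* The quadratic relation says (2 alb + 5)^2 = 19, so the determinant is nonzero. *)
apply/negP => /eqP /(congr1 (fun z => z ^+ 2 / 9)).
rewrite (_ : _ / 9 = 2 * (2 * alb ^+ 2 + 10 * alb + 3) + 19); last by field.
rewrite sk mulr0 add0r expr0n mul0r => /eqP; by rewrite pnatr_eq0.
Qed.

Lemma homogeneous_classify k al alb f : al - alb = k%:R -> (0 < k)%N -> alb != 0 ->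
  cocycle al alb f -> is_homog k f ->
  (exists t, f = cobound al alb (t *: 'X^k)) \/
  (class_exists k alb /\ exists c t,
     f = cc c * homog k (class_coefs k alb) + cobound al alb (t *: 'X^k)).
Proof.
move=> alk k0 albN0 cf hf.
have dec : (1 < k)%N -> class_exists k alb -> class_exists k alb /\ exists c t,
    f = cc c * homog k (class_coefs k alb) + cobound al alb (t *: 'X^k).
  move=> k1 sk; split=> //; apply: homogeneous_decompose => //; try exact: cocycle_class.
  - by case: (k) sk => [|[|[|[|[|[|[|]]]]]]].
  - by case: (k) sk => [|[|[|[|[|[|[|]]]]]]].
  - exact: class_det.
have [k7|] := ltnP 6 k.
  by left; apply: homogeneous_trivial => //; [lia | apply: obstruction7 cf].
have [k5 k6|] := ltnP 4 k.
  have /eqP := obstruction5 k5 cf; rewrite mulf_eq0 => /orP[|/eqP]; last first.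
    by left; apply: homogeneous_trivial => //; lia.
  move=> P0; right; apply: dec; first by lia.
  have [ke|ke] : k = 5%N \/ k = 6%N by lia.
    move: P0; rewrite ke /quadric (_ : _ - _ = 4 * alb * (alb + 4)); last by ring.
    by rewrite !mulf_eq0 pnatr_eq0 (negbTE albN0) addr_eq0 => /eqP.
  move: P0; rewrite ke /quadric (_ : _ - _ = 2 * (2 * alb ^+ 2 + 10 * alb + 3)); last by ring.
  by rewrite mulf_eq0 pnatr_eq0 => /eqP.
case: (ltnP 1 k) => [k1 k4 _|k1 _ _].
  right; apply: dec => //.
  by case: (k) k1 k4 => [|[|[|[|[|]]]]].
have ke : k = 1%N by lia.
(* Only lam^2 occurs in degree 2, and the coboundary of d has coefficient alb there. *)
rewrite ke in alk hf *; left; exists (f`_2`_0 / alb); rewrite -[RHS]add0r.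
apply: homogeneous_match => //.
- by move=> x l m; rewrite /ev2 !horner0; ring.
- by move=> i s _; rewrite !coef0.
- by rewrite !coef0 add0r weight_nn mulfVK.
rewrite hf // !coef0 /weight !bin_small //; ring.
Qed.

Lemma cocycle_classify al alb f : alb != 0 -> cocycle al alb f ->
  [\/ exists phi, f = cobound al alb phi,
      al = alb /\ exists a0 a1 phi, (a0, a1) != (0, 0) /\
        f = cc a0 + cc a1 * Pl R + cobound al alb phi
    | exists k c phi, [/\ class_exists k alb, al - alb = k%:R, c != 0 &
        f = cc c * homog k (class_coefs k alb) + cobound al alb phi]].
Proof.
move=> albN0 /cocycle_reduce/(_ albN0)[phi []].
set f' := f - _ => cf' f0S f00 fS.
have fE : f = f' + cobound al alb phi by rewrite subrK.
clearbody f'.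
have [f'0|f'N0] := eqVneq f' 0.
  by apply: Or31; exists phi; rewrite fE f'0 add0r.
(* If al and alb differ, any nonzero coefficient d^s lam^(i+1) of the reduced cocycle forces al -
   alb = s + i. *)
have [k alk] : exists k : nat, al - alb = k%:R.
  case: (eqVneq al alb) => [->|alN]; first by exists 0%N; rewrite subrr.
  pose i := (size f').-1.
  have fi : f'`_i != 0 by rewrite -lead_coefE lead_coef_eq0.
  pose s := (size f'`_i).-1.
  have fis : f'`_i`_s != 0 by rewrite -lead_coefE lead_coef_eq0.
  case: i fi @s fis => [|i] fi s fis.
    move: fis; case: s => [|s]; last by rewrite f0S eqxx.
    move/eqP: f00; rewrite mulf_eq0 subr_eq0 (negbTE alN) /= => /eqP->.
    by rewrite eqxx.
  exists (s + i)%N; apply/esym/eqP; apply: contraNT fis => /fS ->.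
  exact: eqxx.
case: (posnP k) => [k0|k0].
  have {alk k0} alk : al = alb by apply/subr0_eq; rewrite alk k0.
  (* For k = 0 only the coefficients of d^0 lam^0 and d^0 lam^1 survive the reduction, giving the
     two parameters. *)
  apply: Or32; split=> //; exists f'`_0`_0, f'`_1`_0, phi.
  have f'E : f' = cc f'`_0`_0 + cc f'`_1`_0 * Pl R.
    apply/polyP => i; apply/polyP => s.
    rewrite coefD coefD coef_ccM /cc /Pl coefC coefX.
    case: i => [|[|i]] /=.
    - by rewrite coef0 mulr0 addr0 coefC; case: s => [|s] /=.
    - rewrite coef0 add0r coef1; case: s => [|s] /=; first by rewrite mulr1.
      by rewrite mulr0 fS // alk subrr pnatr_eq0.
    rewrite !coef0 mulr0 addr0 fS // alk subrr pnatr_eq0; lia.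
  split; last by rewrite -f'E.
  by apply: contraNneq f'N0 => -[e0 e1]; rewrite f'E e0 e1 /cc !polyC0 mul0r addr0.
have hf' : is_homog k f'.
  (* The reduction could not touch d^k lam. In the relation of m l^(k+1) d^0 the Euler factor
     vanishes and leaves alb times this coefficient. *)
  have f'1k : f'`_1`_k = 0.
    have := cocycle_coef1 k.-1 0 cf'; rewrite prednK // add0n alk subrr mul0r add0r.
    by rewrite weight_nn => /eqP; rewrite mulf_eq0 (negbTE albN0) => /eqP.
  move=> [|i] s.
    move=> _; case: s => [|s]; last exact: f0S.
    by move/eqP: f00; rewrite alk mulf_eq0 pnatr_eq0 gtn_eqF //= => /eqP.
  move=> his; have [e|] := eqVneq (s + i)%N k; last first.
    by move=> h; apply: fS; rewrite alk eqr_nat.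
  have i0 : i = 0%N by lia.
  by move: e; rewrite i0 addn0 => ->.
case: (homogeneous_classify alk k0 albN0 cf' hf') => [[t f'E]|[sk [c [t f'E]]]].
  by apply: Or31; exists (t *: 'X^k + phi); rewrite coboundD -f'E.
case: (eqVneq c 0) => [c0|cN0].
  apply: Or31; exists (t *: 'X^k + phi).
  by rewrite coboundD fE f'E c0 /cc !polyC0 mul0r add0r.
apply: Or33; exists k, c, (t *: 'X^k + phi); split=> //.
by rewrite coboundD addrA -f'E.
Qed.

End Classification.

(** * From extensions to cocycles *)

Section Extensions.
Variable R : numClosedFieldType.
Implicit Types (f g F : {poly {poly R}}) (phi : {poly R}) (a b al alb be : R).

(** Puts cases (ii) to (vi) in the uniform form k = 2, ..., 6 used by the classification. *)
Lemma good_FP al alb F : good_F al alb F <->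
  (al = alb /\ exists a0 a1, (a0, a1) != (0, 0) /\ F = cc a0 + cc a1 * Pl R) \/
  (exists k c, [/\ class_exists k alb, al - alb = k%:R, c != 0 &
                   F = cc c * homog k (class_coefs k alb)]).
Proof.
have ev2_eq k c (G : {poly {poly R}}) :
    (forall x l, ev2 G x l = c * ev2 (homog k (class_coefs k alb)) x l) ->
    G = cc c * homog k (class_coefs k alb).
  by move=> h; apply: ev2_inj => x l; rewrite ev2M ev2_cc.
pose E := (ev2_homog, big_ord_recr, big_ord0).
have e2 c : cc c * (Pl R) ^+ 2 * (2 * Pd R + Pl R) = cc c * homog 2 (class_coefs 2 alb).
  by apply: ev2_eq => x l; rewrite !ev2E !E /=; ring.
have e3 c : cc c * Pd R * (Pl R) ^+ 2 * (Pd R + Pl R) = cc c * homog 3 (class_coefs 3 alb).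
  by apply: ev2_eq => x l; rewrite !ev2E !E /=; ring.
have e4 c : cc c * (Pl R) ^+ 2 * (4 * (Pd R) ^+ 3 + 6 * (Pd R) ^+ 2 * Pl R
     - Pd R * (Pl R) ^+ 2 + cc alb * (Pl R) ^+ 3) = cc c * homog 4 (class_coefs 4 alb).
  by apply: ev2_eq => x l; rewrite !ev2E !E /=; ring.
have e5 c : cc c * ((Pd R) ^+ 4 * (Pl R) ^+ 2 - 10 * (Pd R) ^+ 2 * (Pl R) ^+ 4
     - 17 * Pd R * (Pl R) ^+ 5 - 8 * (Pl R) ^+ 6) = cc c * homog 5 (class_coefs 5 alb).
  by apply: ev2_eq => x l; rewrite !ev2E !E /=; ring.
have e6 c : cc c * ((Pd R) ^+ 4 * (Pl R) ^+ 3
     - cc (2 * alb + 3) * (Pd R) ^+ 3 * (Pl R) ^+ 4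
     - cc (3 * alb) * (Pd R) ^+ 2 * (Pl R) ^+ 5
     - cc (3 * alb + 1) * Pd R * (Pl R) ^+ 6
     - cc (alb + 9 / 28) * (Pl R) ^+ 7) = cc c * homog 6 (class_coefs 6 alb).
  by apply: ev2_eq => x l; rewrite !ev2E !E /=; ring.
split.
  case=> [[alE h]|]; first by left.
  case=> [[h2 [c [cN0 ->]]]|]; first by right; exists 2%N, c; rewrite e2.
  case=> [[h3 [c [cN0 ->]]]|]; first by right; exists 3%N, c; rewrite e3.
  case=> [[h4 [c [cN0 ->]]]|]; first by right; exists 4%N, c; rewrite e4.
  case=> [[[h5 h5'] [c [cN0 ->]]]|].
    by right; exists 5%N, c; rewrite e5; split=> //; rewrite h5 h5'; ring.
  case=> [[s [s2 [alE albE]]] [c [cN0 ->]]].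
  right; exists 6%N, c; rewrite e6; split=> //; last by rewrite alE albE; field.
  rewrite /= albE (_ : _ + 3 = (s ^+ 2 - 19) / 2); last by field.
  by rewrite s2 subrr mul0r.
case=> [[alE h]|[k [c [sk alk cN0 ->]]]]; first by left.
right; case: k sk alk => [|[|[|[|[|[|[|]]]]]]] // sk alk.
- by left; split=> //; exists c; rewrite e2.
- by right; left; split=> //; exists c; rewrite e3.
- by do 2 right; left; split=> //; exists c; rewrite e4.
- do 3 right; left; split; last by exists c; rewrite e5.
  by split=> //; rewrite -[al](subrK alb) alk sk; ring.
do 4 right; split; last by exists c; rewrite e6.
(* Solves alb = -5/2 + s/2 for s; both square roots of 19 are covered. *)
exists (2 * alb + 5); split; last split.
- transitivity (2 * (2 * alb ^+ 2 + 10 * alb + 3) + 19); first by ring.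
  by rewrite sk mulr0 add0r.
- by rewrite -[al](subrK alb) alk; field.
by field.
Qed.

Lemma good_F_cocycle al alb F : good_F al alb F -> cocycle al alb F.
Proof.
move=> /good_FP[[-> [a0 [a1 [_ ->]]]] | [k [c [sk alk _ ->]]]].
  by move=> x l m; rewrite !ev2E; ring.
exact/cocycleZ/cocycle_class.
Qed.

Lemma good_F_nontrivial al alb F phi :
  good_F al alb F -> F <> cobound al alb phi.
Proof.
move=> /good_FP[[-> [a0 [a1 [aN0 ->]]]] | [k [c [sk alk cN0 ->]]]] e.
  (* A coboundary vanishes at lam = 0, and its d^0 lam coefficient is (alb - al) phi(0), zero when
     al = alb. *)
  case/negP: aN0; apply/eqP; congr (_, _).
    have := congr1 (fun f : {poly {poly R}} => f`_0`_0) e.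
    rewrite coef_cobound0 coefD coefD coef_ccM /cc /Pl coefC coefX /= coefC /= => <-.
    by rewrite coef0 mulr0 addr0.
  have := congr1 (fun f : {poly {poly R}} => f`_1`_0) e.
  rewrite coef_coboundS coefD coefD coef_ccM /cc /Pl coefC coefX /=.
  rewrite coef0 coef1 /= mulr1 add0r weight0 => ->; ring.
have k1 : (1 < k)%N by case: (k) sk => [|[|]].
apply: (homog_nontrivial (phi := c^-1 *: phi) alk k1 (class_det sk)).
by rewrite coboundZ -e /cc mulrA -!polyCM mulVf // !polyC1 mul1r.
Qed.

Lemma good_pair_good_F al alb : good_pair al alb <-> exists F, good_F al alb F.
Proof.
have N0 : 1 != 0 :> R := oner_neq0 R.
split; last first.
  rewrite /good_pair; case=> F.
  by do ![case=> [[h _]|]; first by tauto]; case=> h _; tauto.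
move=> [h|[h|[h|[h|[h|h]]]]]; last first.
- by eexists; do 5 right; split=> //; exists 1.
- by eexists; do 4 right; left; split=> //; exists 1.
- by eexists; do 3 right; left; split=> //; exists 1.
- by eexists; do 2 right; left; split=> //; exists 1.
- by eexists; right; left; split=> //; exists 1.
eexists; left; split=> //; exists 1, 0; split=> //.
by rewrite xpair_eqE negb_and N0.
Qed.

Lemma horner_shiftp l (p : {poly R}) x : (shiftp l p).[x] = p.[x + l].
Proof. by rewrite /shiftp horner_comp !hornerE. Qed.

Lemma ev2_subbeta be F x l : ev2 (subbeta be F) x l = ev2 F (x + be) l.
Proof.
transitivity (F.[l%:P] \Po ('X + be%:P)).[x]; last by rewrite horner_comp !hornerE.
by congr (_.[x]); rewrite -(horner_map (comp_poly ('X + be%:P))) /= comp_polyC.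
Qed.

Lemma subbetaK be f : subbeta be (subbeta (- be) f) = f.
Proof. by apply: ev2_inj => x l; rewrite !ev2_subbeta addrK. Qed.

Lemma subbeta0 be : subbeta be (0 : {poly {poly R}}) = 0.
Proof. by apply: ev2_inj => x l; rewrite ev2_subbeta /ev2 !horner0. Qed.

Lemma actL1 al alb be f g l v x : (act al alb be f g GL l v).1.[x] =
  v.1.[x + l] * (x + alb * l + be) + v.2.[x + l] * ev2 f x l.
Proof. by rewrite /= hornerD !hornerM !horner_shiftp hornerD hornerX hornerC addrA. Qed.

Lemma actL2 al alb be f g l v x : (act al alb be f g GL l v).2.[x] =
  v.2.[x + l] * (x + al * l + be).
Proof. by rewrite /= !hornerM !horner_shiftp hornerD hornerX hornerC addrA. Qed.

Lemma actW1 al alb be f g l v x : (act al alb be f g GW l v).1.[x] =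
  v.2.[x + l] * ev2 g x l.
Proof. by rewrite /= !hornerM !horner_shiftp. Qed.

Lemma actW2 al alb be f g l v x : (act al alb be f g GW l v).2.[x] = 0.
Proof. by rewrite /= horner0. Qed.

Definition actE := (actL1, actL2, actW1, actW2).

Lemma epair_eq (v w : {poly R} * {poly R}) :
  (forall x, v.1.[x] = w.1.[x]) -> (forall x, v.2.[x] = w.2.[x]) -> v = w.
Proof.
case: v w => [v1 v2] [w1 w2] /= h1 h2.
by rewrite (poly_eqP h1) (poly_eqP h2).
Qed.

Lemma esub_at (v w : {poly R} * {poly R}) x :
  (esub v w).1.[x] = v.1.[x] - w.1.[x] /\ (esub v w).2.[x] = v.2.[x] - w.2.[x].
Proof. by rewrite /= !hornerD !hornerN. Qed.

Lemma escal_at c (v : {poly R} * {poly R}) x :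
  (escal c v).1.[x] = c * v.1.[x] /\ (escal c v).2.[x] = c * v.2.[x].
Proof. by rewrite /= !hornerZ. Qed.

Lemma fst_at (v w : {poly R} * {poly R}) x : v = w -> v.1.[x] = w.1.[x].
Proof. by move->. Qed.

(* At lam = 0 the bracket relation of L and W reads b g = 0. *)
Lemma is_ext_W0 a b al alb be f g : b != 0 ->
  is_ext a b al alb be f g -> g = 0.
Proof.
move=> bN0 ext; apply: ev2_inj => x m; rewrite [RHS]/ev2 !horner0.
have [_ /(@fst_at _ _ x) + _ _] := ext 0 m (0, 1%:P).
rewrite (esub_at _ _ _).1 (escal_at _ _ _).1 !actE /= !hornerC !addr0 add0r => h.
apply: (mulfI bN0); rewrite mulr0.
move: h => /eqP; rewrite -subr_eq0 => /eqP h.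
rewrite -[RHS]oppr0 -h; ring.
Qed.

Lemma actW0 al alb be f l v : act al alb be f 0 GW l v = (0, 0).
Proof. by rewrite /act /evl horner0 mulr0. Qed.

Lemma actL0 al alb be f g l : act al alb be f g GL l (0, 0) = (0, 0).
Proof. by rewrite /act /shiftp /= !comp_poly0 !mul0r addr0. Qed.

(** With g = 0 only the relation of L with L remains. On v_al, at d = x - be, it is the cocycle
    identity; on a general v the defect is a multiple of that identity by the shifted second
    component. *)
Lemma is_ext_cocycle a b al alb be F :
  is_ext a b al alb be (subbeta be F) 0 <-> cocycle al alb F.
Proof.
split=> [ext x l m|cF l m v].
  have [/(@fst_at _ _ (x - be)) + _ _ _] := ext l m (0, 1%:P).
  rewrite (esub_at _ _ _).1 (escal_at _ _ _).1 !(actL1, actL2) /= !horner0 !hornerC !ev2_subbeta.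
  rewrite !(addrAC x (- be)) !subrK !addrK => h.
  apply: (etrans _ (etrans h _)); ring.
have cFx x := cF (x + be) l m.
split; rewrite ?actW0 ?actL0; first apply: epair_eq => x.
- rewrite (esub_at _ _ _).1 (escal_at _ _ _).1 !(actL1, actL2) !ev2_subbeta.
  move: (cFx x); rewrite !(addrAC x _ be) (addrAC x m l) (addrA x l m) => /eqP.
  rewrite -subr_eq0 => /eqP h; apply/subr0_eq.
  rewrite -[RHS](mulr0 v.2.[x + l + m]) -h; ring.
- rewrite (esub_at _ _ _).2 (escal_at _ _ _).2 !(actL1, actL2).
  rewrite (addrAC x m l) (addrA x l m); ring.
- by rewrite /esub /escal /= subr0 scaler0.
- by rewrite /esub /escal /= subr0 scaler0.
by rewrite /esub /= subr0.
Qed.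

(** A C[d]-linear map compatible with both end terms is fixed by v_al -> v_al + phi0(d) v_abar;
    commuting with L on v_al is then the coboundary equation, shifted by be. *)
Lemma ext_equiv_cobound al alb be F F' :
  ext_equiv al alb be (subbeta be F) 0 (subbeta be F') 0 <->
  exists phi, F = F' + cobound al alb phi.
Proof.
split=> [[Phi [PhiD PhiM Phi1 Phi2 PhiA]]|[phi FE]].
  have PhiE v : Phi v = (v.1 + v.2 * (Phi (0, 1)).1, v.2).
    have {1}-> : v = eadd (v.1, 0) (epmul v.2 (0, 1)).
      by case: v => v1 v2; rewrite /eadd /epmul /= mulr0 mulr1 addr0 add0r.
    by rewrite PhiD PhiM Phi1 /eadd /epmul /= Phi2 /= mulr1 add0r.
  set phi0 := (Phi (0, 1)).1 in PhiE.
  have Phi_at v x : (Phi v).1.[x] = v.1.[x] + v.2.[x] * phi0.[x].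
    by rewrite PhiE /= hornerD hornerM.
  exists (phi0 \Po ('X - be%:P)); apply: ev2_inj => x l.
  have /(@fst_at _ _ (x - be)) := PhiA GL l (0, 1%:P).
  rewrite Phi_at !(actL1, actL2) Phi_at Phi2 /= !horner0 !hornerC !ev2_subbeta.
  rewrite ev2D ev2_cobound !horner_comp !(hornerD, hornerX, hornerN, hornerC).
  rewrite !(addrAC x (- be)) !subrK !addrK => /eqP.
  rewrite -subr_eq0 => /eqP h; apply/subr0_eq; rewrite -[RHS]h; ring.
pose phi0 := phi \Po ('X + be%:P).
have phi0E x : phi0.[x] = phi.[x + be] by rewrite horner_comp !hornerE.
exists (fun v => (v.1 + v.2 * phi0, v.2)); split=> //.
- by move=> v w; rewrite /eadd /= mulrDl; congr (_, _); ring.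
- by move=> r v; rewrite /epmul /=; congr (_, _); ring.
- by move=> p /=; rewrite mul0r addr0.
move=> X l v; apply: epair_eq => x; last by case: X.
case: X; last by rewrite !actW0 /= mul0r addr0.
rewrite [LHS]hornerD hornerM !(actL1, actL2) /= hornerD hornerM.
rewrite !ev2_subbeta FE ev2D ev2_cobound !phi0E (addrAC x l be); ring.
Qed.

End Extensions.

Theorem theorem3p9 (R : numClosedFieldType) (a b al alb be : R) :
  b != 0 -> al != 0 -> alb != 0 ->
  [/\ forall f g : {poly {poly R}}, is_ext a b al alb be f g -> g = 0,
      (exists f g : {poly {poly R}},
          is_ext a b al alb be f g /\ ~ ext_trivial al alb be f g)
        <-> good_pair al alb
    & forall f g : {poly {poly R}},
        is_ext a b al alb be f g -> ~ ext_trivial al alb be f g ->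
        exists F : {poly {poly R}},
          [/\ good_F al alb F, is_ext a b al alb be (subbeta be F) 0
            & ext_equiv al alb be f g (subbeta be F) 0]].
Proof.
move=> bN0 _ albN0.
have trivialE F : ext_trivial al alb be (subbeta be F) 0 <->
    exists phi, F = cobound al alb phi.
  rewrite /ext_trivial -[X in ext_equiv _ _ _ _ _ X _](subbeta0 be).
  split=> [/ext_equiv_cobound|] [phi h].
    by exists phi; rewrite h add0r.
  by apply/ext_equiv_cobound; exists phi; rewrite add0r.
have classify f g : is_ext a b al alb be f g -> ~ ext_trivial al alb be f g ->
    exists F, [/\ good_F al alb F, is_ext a b al alb be (subbeta be F) 0
            & ext_equiv al alb be f g (subbeta be F) 0].
  move=> ext; have g0 := is_ext_W0 bN0 ext; move: ext; rewrite {}g0.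
  (* Every f is a shift by be of some polynomial, which reduces the problem to cocycles without
     be. *)
  rewrite -[f](subbetaK be); move: (subbeta (- be) f) => {}f.
  move=> /is_ext_cocycle cf ntriv.
  suff [F [phi [gF fE]]] : exists F phi, good_F al alb F /\ f = F + cobound al alb phi.
    exists F; split=> //; first exact/is_ext_cocycle/good_F_cocycle.
    by apply/ext_equiv_cobound; exists phi.
  case: (cocycle_classify albN0 cf) => [/trivialE //|[alE h]|[k [c [phi [sk alk cN0 fE]]]]].
    move: h => [a0 [a1 [phi [aN0 fE]]]].
    exists (cc a0 + cc a1 * Pl R), phi; split=> //.
    by apply/good_FP; left; split=> //; exists a0, a1.
  exists (cc c * homog k (class_coefs k alb)), phi; split=> //.
  by apply/good_FP; right; exists k, c.
split=> //; first by move=> f g; apply: is_ext_W0.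
rewrite good_pair_good_F; split=> [[f [g [/classify h /h[F [gF _ _]]]]]|[F gF]].
  by exists F.
exists (subbeta be F), 0; split; first exact/is_ext_cocycle/good_F_cocycle.
by move=> /trivialE[phi]; apply: good_F_nontrivial.
Qed.
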